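(* For all integers $n, k \geq 0$, \[ 2^{n+k}\, T(n+k,k) = \binom{n+k}{k}\sum_{l=0}^n d_l^{(-k)}\, S_2(n,l). \]
   Context: All generating functions are formal power series in $t$. For $\alpha\in\mathbb{R}$, the type 2 Daehee polynomials of order $\alpha$ are defined by $\left(\frac{\log(1+t)}{(1+t)-(1+t)^{-1}}\right)^{\alpha}(1+t)^x = \sum_{n\ge0} d_n^{(\alpha)}(x)\frac{t^n}{n!}$, and $d_n^{(\alpha)} = d_n^{(\alpha)}(0)$ are the type 2 Daehee numbers of order $\alpha$. The Stirling numbers of the second kind $S_2(n,l)$ are defined by $\frac{1}{l!}(e^t-1)^l = \sum_{n\ge l} S_2(n,l)\frac{t^n}{n!}$. The central factorial is $x^{[0]}=1$ and $x^{[n]} = x\,(x+\frac{n}{2}-1)(x+\frac{n}{2}-2)\cdots(x-\frac{n}{2}+1)$ for $n\ge1$; the central factorial numbers of the second kind $T(n,k)$ are defined by $x^n = \sum_{k=0}^n T(n,k)\,x^{[k]}$ for $n \ge 0$. *)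

(* Defs.v *)
From HB Require Import structures.
From mathcomp Require Import all_boot all_order all_algebra.
From mathcomp Require Import ring zify.
From mathcomp Require Import boolp reals exp.

Set Implicit Arguments.
Unset Strict Implicit.
Unset Printing Implicit Defensive.

Import Order.TTheory GRing.Theory Num.Theory.

Local Open Scope ring_scope.

(* Formal power series in t; [f n] is the coefficient of t^n. *)
Record fps (R : Type) := Fps { fps_coef :> nat -> R }.

HB.instance Definition _ (R : Type) := gen_eqMixin (fps R).
HB.instance Definition _ (R : Type) := gen_choiceMixin (fps R).

Lemma fpsP (R : Type) (f g : fps R) : (forall n, f n = g n) <-> f = g.
Proof.
split=> [|-> //]; case: f => f; case: g => g /= fg.
by congr Fps; apply: funext.
Qed.

Section Ring.
Variable R : comNzRingType.
Implicit Types f g h : fps R.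

Definition fps_add f g := Fps (fun n => f n + g n).
Definition fps_opp f := Fps (fun n => - f n).
Definition fps_zero : fps R := Fps (fun=> 0).
Definition fps_one : fps R := Fps (fun n => (n == 0)%:R).
Definition fps_mul f g := Fps (fun n => \sum_(i < n.+1) f i * g (n - i)%N).
Definition fps_scale (a : R) f := Fps (fun n => a * f n).

Lemma fps_addA : associative fps_add.
Proof. by move=> f g h; apply/fpsP => n /=; rewrite addrA. Qed.
Lemma fps_addC : commutative fps_add.
Proof. by move=> f g; apply/fpsP => n /=; rewrite addrC. Qed.
Lemma fps_add0 : left_id fps_zero fps_add.
Proof. by move=> f; apply/fpsP => n /=; rewrite add0r. Qed.
Lemma fps_addN : left_inverse fps_zero fps_opp fps_add.
Proof. by move=> f; apply/fpsP => n /=; rewrite addNr. Qed.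

HB.instance Definition _ :=
  GRing.isZmodule.Build (fps R) fps_addA fps_addC fps_add0 fps_addN.

Let tr N f : {poly R} := \poly_(i < N.+1) f i.

Let coef_tr N f n : (n <= N)%N -> (tr N f)`_n = f n.
Proof. by move=> nN; rewrite coef_poly ltnS nN. Qed.

Let coefM_tr N f (p q : {poly R}) g n : (n <= N)%N ->
  (forall i, (i <= N)%N -> p`_i = f i) -> (forall i, (i <= N)%N -> q`_i = g i) ->
  (p * q)`_n = fps_mul f g n.
Proof.
move=> nN pf qg; rewrite coefM; apply: eq_bigr => i _.
rewrite pf ?qg //; first exact: leq_trans (leq_subr _ _) nN.
by apply: leq_trans nN; rewrite -ltnS.
Qed.

Let mul_tr N f g n : (n <= N)%N -> (tr N f * tr N g)`_n = fps_mul f g n.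
Proof. by move=> nN; apply: (coefM_tr nN) => i iN; rewrite coef_tr. Qed.

Lemma fps_mulA : associative fps_mul.
Proof.
move=> f g h; apply/fpsP => n.
rewrite -(@coefM_tr n _ (tr n f) (tr n g * tr n h)) //; last 2 first.
- by move=> i iN; rewrite coef_tr.
- by move=> i iN; rewrite mul_tr.
rewrite -(@coefM_tr n _ (tr n f * tr n g) (tr n h)) ?mulrA //.
- by move=> i iN; rewrite mul_tr.
- by move=> i iN; rewrite coef_tr.
Qed.
Lemma fps_mulC : commutative fps_mul.
Proof.
by move=> f g; apply/fpsP => n; rewrite -!(@mul_tr n) // mulrC.
Qed.
Lemma fps_mul1 : left_id fps_one fps_mul.
Proof.
move=> f; apply/fpsP => n /=; rewrite big_ord_recl /= mul1r subn0.
by rewrite big1 ?addr0 // => i _; rewrite mul0r.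
Qed.
Lemma fps_mulDl : left_distributive fps_mul fps_add.
Proof.
move=> f g h; apply/fpsP => n /=; rewrite -big_split /=.
by apply: eq_bigr => i _; rewrite mulrDl.
Qed.
Lemma fps_one_neq0 : fps_one != 0.
Proof.
by apply/eqP => /fpsP /(_ 0%N) /= /eqP; rewrite oner_eq0.
Qed.

HB.instance Definition _ := GRing.Zmodule_isComNzRing.Build (fps R)
  fps_mulA fps_mulC fps_mul1 fps_mulDl fps_one_neq0.

Lemma fps_scaleA a b f : fps_scale a (fps_scale b f) = fps_scale (a * b) f.
Proof. by apply/fpsP => n /=; rewrite mulrA. Qed.
Lemma fps_scale1 : left_id 1 fps_scale.
Proof. by move=> f; apply/fpsP => n /=; rewrite mul1r. Qed.
Lemma fps_scaleDr : right_distributive fps_scale +%R.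
Proof. by move=> a f g; apply/fpsP => n /=; rewrite mulrDr. Qed.
Lemma fps_scaleDl f : {morph fps_scale^~ f : a b / a + b}.
Proof. by move=> a b; apply/fpsP => n /=; rewrite mulrDl. Qed.

HB.instance Definition _ := GRing.Zmodule_isLmodule.Build R (fps R)
  fps_scaleA fps_scale1 fps_scaleDr fps_scaleDl.

Lemma fps_scaleAl a f g : a *: (f * g) = (a *: f) * g.
Proof.
apply/fpsP => n /=; rewrite mulr_sumr.
by apply: eq_bigr => i _; rewrite mulrA.
Qed.

HB.instance Definition _ := GRing.Lmodule_isLalgebra.Build R (fps R) fps_scaleAl.
HB.instance Definition _ := GRing.Lalgebra_isComAlgebra.Build R (fps R).

Lemma fps_coefD f g n : (f + g) n = f n + g n. Proof. by []. Qed.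
Lemma fps_coefN f n : (- f) n = - f n. Proof. by []. Qed.
Lemma fps_coefB f g n : (f - g) n = f n - g n. Proof. by []. Qed.
Lemma fps_coef0 n : (0 : fps R) n = 0. Proof. by []. Qed.
Lemma fps_coef1 n : (1 : fps R) n = (n == 0)%:R. Proof. by []. Qed.
Lemma fps_coefM f g n : (f * g) n = \sum_(i < n.+1) f i * g (n - i)%N.
Proof. by []. Qed.
Lemma fps_coefZ a f n : (a *: f) n = a * f n. Proof. by []. Qed.
Lemma fps_coef_sum (I : Type) (r : seq I) (P : pred I) (F : I -> fps R) n :
  (\sum_(i <- r | P i) F i) n = \sum_(i <- r | P i) F i n.
Proof. by elim/big_rec2: _ => //= i a b _ <-. Qed.

Definition fpsX : fps R := Fps (fun n => (n == 1%N)%:R).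

(* Division by t; meaningful when [f 0 = 0]. *)
Definition fps_divX f : fps R := Fps (fun n => f n.+1).

Lemma fps_divXK f : f 0%N = 0 -> fpsX * fps_divX f = f.
Proof.
move=> f0; apply/fpsP => -[|n]; rewrite fps_coefM.
  by rewrite big_ord1 mul0r f0.
rewrite 2!big_ord_recl /= mul0r mul1r add0r subSS subn0 big1 ?addr0 // => i _.
by rewrite mul0r.
Qed.

(* g(f(t)); meaningful when [f 0 = 0], in which case f^j has no term of
   degree < j and the sum may stop at j = n. *)
Definition fps_comp g f : fps R :=
  Fps (fun n => \sum_(j < n.+1) g j * (f ^+ j) n).

Lemma fps_exp_lt f j n : f 0%N = 0 -> (n < j)%N -> (f ^+ j) n = 0.
Proof.
move=> f0; elim: j n => // j IHj n nj; rewrite exprS fps_coefM.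
apply: big1 => -[[|i] /= ilt] _; first by rewrite f0 mul0r.
by rewrite IHj ?mulr0 //; rewrite /bump /=; lia.
Qed.

Lemma fps_comp_trunc g f N n : f 0%N = 0 -> (n <= N)%N ->
  fps_comp g f n = (\sum_(j < N.+1) g j *: f ^+ j) n.
Proof.
move=> f0 nN; rewrite fps_coef_sum /=.
rewrite (big_ord_widen N.+1 (fun j => g j * (f ^+ j) n)) // big_mkcond.
apply: eq_bigr => j _; case: ifPn => //.
by rewrite -leqNgt => nj; rewrite fps_exp_lt ?mulr0.
Qed.

End Ring.

Arguments fpsX {R}.

Section Series.
Variable R : realType.
Implicit Types (f g : fps R) (a x : R).

Definition gbinom a (j : nat) : R := (\prod_(i < j) (a - i%:R)) / j`!%:R.

(* The multiplicative inverse f_0^-1 \sum_j (1 - f/f_0)^j, for [f 0 != 0]. *)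
Definition fps_inv f : fps R :=
  (f 0%N)^-1 *: fps_comp (Fps (fun=> 1)) (1 - (f 0%N)^-1 *: f).

(* The real power f^a = f_0^a \sum_j (a choose j) (f/f_0 - 1)^j,
   for [0 < f 0]. *)
Definition fps_powr f a : fps R :=
  (f 0%N `^ a) *: fps_comp (Fps (gbinom a)) ((f 0%N)^-1 *: f - 1).

Definition fps_exp : fps R := Fps (fun n => n`!%:R^-1).

(* log(1+t); the constant term is 1 / 0 = 0. *)
Definition fps_log1p : fps R := Fps (fun n => (-1) ^+ n.-1 / n%:R).

Definition fps_daehee_den : fps R := (1 + fpsX) - fps_inv (1 + fpsX).

(* log(1+t) / ((1+t) - (1+t)^-1), after cancelling a factor t in the
   numerator and in the denominator. *)
Definition fps_daehee_base : fps R :=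
  fps_divX fps_log1p * fps_inv (fps_divX fps_daehee_den).

Definition daehee_poly a (n : nat) x : R :=
  n`!%:R * (fps_powr fps_daehee_base a * fps_powr (1 + fpsX) x) n.

Definition daehee a (n : nat) : R := daehee_poly a n 0.

Definition stirling2 (n l : nat) : R :=
  n`!%:R * (l`!%:R^-1 *: (fps_exp - 1) ^+ l) n.

(* x (x + n/2 - 1) (x + n/2 - 2) ... (x - n/2 + 1), as a polynomial in x. *)
Definition centfact (n : nat) : {poly R} :=
  if n is 0%N then 1 else 'X * \prod_(1 <= i < n) ('X + (n%:R / 2 - i%:R)%:P).

Lemma fps_mulV f : f 0%N != 0 -> f * fps_inv f = 1.
Proof.
move=> f0; set u := 1 - (f 0%N)^-1 *: f.
have u0 : u 0%N = 0 by rewrite /u fps_coefB fps_coefZ mulVf // subrr.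
have uE : (f 0%N)^-1 *: f = 1 - u by rewrite /u opprB addrC subrK.
rewrite /fps_inv -/u -scalerAr scalerAl uE.
apply/fpsP => n.
transitivity (((1 - u) * \sum_(j < n.+1) u ^+ j) n).
  rewrite !fps_coefM; apply: eq_bigr => i _; congr (_ * _).
  rewrite (@fps_comp_trunc _ _ _ n) ?leq_subr //.
  by congr (fps_coef _ _); apply: eq_bigr => j _; rewrite scale1r.
rewrite -[1 - u]opprB mulNr -subrX1.
by rewrite fps_coefN fps_coefB fps_exp_lt // sub0r opprK.
Qed.

Lemma gbinom_nat (k j : nat) : gbinom k%:R j = 'C(k, j)%:R.
Proof.
rewrite /gbinom; apply: (canLR (mulfK _)); first by rewrite pnatr_eq0 -lt0n fact_gt0.
rewrite -natrM bin_ffact; elim: j => [|j IHj]; first by rewrite big_ord0.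
rewrite big_ord_recr /= IHj ffactnSr natrM.
have [jk|kj] := leqP j k; first by rewrite natrB.
by rewrite ffact_small // !mul0r.
Qed.

Lemma fps_powrn f (k : nat) : 0 < f 0%N -> fps_powr f k%:R = f ^+ k.
Proof.
move=> f0; have fn0 := lt0r_neq0 f0.
set u := (f 0%N)^-1 *: f - 1.
have u0 : u 0%N = 0 by rewrite /u fps_coefB fps_coefZ mulVf // subrr.
have fE : f = f 0%N *: (u + 1) by rewrite /u subrK scalerA divff // scale1r.
rewrite /fps_powr -/u powR_mulrn ?ltW // [in RHS]fE.
rewrite exprZn; congr (_ *: _); apply/fpsP => n.
rewrite (@fps_comp_trunc _ _ _ (maxn n k)) ?leq_maxl // addrC exprDn.
rewrite (big_ord_widen _ (fun j : nat => 1 ^+ (k - j) * u ^+ j *+ 'C(k, j))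
  (leq_maxr n.+1 k.+1)) maxnSS !fps_coef_sum [RHS]big_mkcond.
apply: eq_bigr => j _ /=; rewrite gbinom_nat expr1n mul1r.
case: ifPn => [_|]; first by rewrite -scaler_nat fps_coefZ.
by rewrite -leqNgt => kj; rewrite bin_small // mul0r.
Qed.

Lemma fps_powrN1 f : 0 < f 0%N -> fps_powr f (-1) = fps_inv f.
Proof.
move=> f0; rewrite /fps_powr /fps_inv powR_inv1 ?ltW //; congr (_ *: _).
apply/fpsP => n /=; apply: eq_bigr => j _.
rewrite -[1 - _]opprB [(- _) ^+ _]exprNn mul1r.
rewrite -[in RHS]signr_odd /gbinom.
have -> : \prod_(i < j) (-1 - i%:R) = (-1) ^+ j * j`!%:R :> R.
  elim: (val j) => [|m IHm]; first by rewrite big_ord0 mulr1.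
  by rewrite big_ord_recr /= IHm factS natrM exprS -natr1; ring.
rewrite mulfK ?pnatr_eq0 -?lt0n ?fact_gt0 // -[in LHS]signr_odd.
by case: (odd j); rewrite ?expr0 ?expr1 ?mul1r ?mulN1r.
Qed.

Lemma fps_daehee_den0 : fps_daehee_den 0%N = 0.
Proof.
have c0 : (1 + fpsX : fps R) 0%N = 1 by rewrite fps_coefD addr0.
have := @fps_mulV (1 + fpsX : fps R); rewrite c0 oner_eq0 => /(_ isT) /fpsP /(_ 0%N).
rewrite fps_coefM big_ord1 c0 mul1r fps_coef1 /fps_daehee_den fps_coefB c0 => ->.
by rewrite subrr.
Qed.

Lemma fps_daehee_den1 : fps_daehee_den 1%N = 2.
Proof.
have c0 : (1 + fpsX : fps R) 0%N = 1 by rewrite fps_coefD addr0.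
have c1 : (1 + fpsX : fps R) 1%N = 1 by rewrite fps_coefD add0r.
have i0 : fps_inv (1 + fpsX : fps R) 0%N = 1.
  have := fps_daehee_den0; rewrite /fps_daehee_den fps_coefB c0.
  by move/eqP; rewrite subr_eq0 => /eqP.
set w : fps R := 1 + fpsX in c0 c1 i0 *.
have := @fps_mulV w; rewrite c0 oner_eq0 => /(_ isT) /fpsP /(_ 1%N).
rewrite fps_coefM big_ord_recr big_ord1 => wV.
have {wV} : w 0%N * fps_inv w 1%N + w 1%N * fps_inv w 0%N = 0 := wV.
rewrite c0 c1 i0 !mul1r => /eqP; rewrite addr_eq0 => /eqP i1.
by rewrite /fps_daehee_den -/w fps_coefB c1 i1 opprK.
Qed.

Lemma fps_daehee_baseE : fps_daehee_base * fps_daehee_den = fps_log1p.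
Proof.
rewrite -[in LHS](fps_divXK fps_daehee_den0) /fps_daehee_base.
have d0 : fps_divX fps_daehee_den 0%N != 0.
  by rewrite -[X in X != _]/(fps_daehee_den 1%N) fps_daehee_den1 pnatr_eq0.
rewrite mulrACA [fps_inv _ * _]mulrC fps_mulV // mulr1 mulrC.
by rewrite fps_divXK //= invr0 mulr0.
Qed.

Lemma fps_daehee_base0 : fps_daehee_base 0%N = 2^-1.
Proof.
have := fps_daehee_baseE => /fpsP /(_ 1%N).
rewrite fps_coefM big_ord_recr big_ord1 => E.
have {E} : fps_daehee_base 0%N * fps_daehee_den 1%N
    + fps_daehee_base 1%N * fps_daehee_den 0%N = 1 / 1 := E.
rewrite fps_daehee_den0 fps_daehee_den1 mulr0 addr0 divr1.
by move/(canRL (mulfK _)) => ->; rewrite ?mul1r // pnatr_eq0.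
Qed.

Lemma centfact_monic_size n : (centfact n \is monic) /\ size (centfact n) = n.+1.
Proof.
case: n => [|n] /=; first by rewrite monic1 size_poly1.
have mon i : 'X + (n.+1%:R / 2 - i%:R)%:P \is @monic R.
  by rewrite -[_%:P]opprK -polyCN monicXsubC.
have pm : \prod_(1 <= i < n.+1) ('X + (n.+1%:R / 2 - i%:R)%:P) \is @monic R.
  exact: monic_prod.
split; first by rewrite monicMl ?monicX.
rewrite size_monicM ?monicX ?monic_neq0 // size_polyX /=.
rewrite size_prod_seq => [|i _]; last exact: monic_neq0.
rewrite (eq_bigr (fun=> 2%N)) => [|i _]; last first.
  by rewrite -[_%:P]opprK -polyCN size_XsubC.
by rewrite sum_nat_const_nat size_iota; lia.
Qed.

Lemma centfact_basis (p : {poly R}) n : (size p <= n)%N ->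
  exists c : nat -> R, p = \sum_(k < n) c k *: centfact k.
Proof.
elim: n p => [|n IHn] p.
  by rewrite leqn0 size_poly_eq0 => /eqP ->; exists (fun=> 0); rewrite big_ord0.
move=> pn; have [/monicP mon sz] := centfact_monic_size n.
have cn : (centfact n)`_n = 1 by rewrite -mon lead_coefE sz.
have [|c pE] := IHn (p - p`_n *: centfact n).
  apply/leq_sizeP => j; rewrite leq_eqVlt => /predU1P[<-|nj].
    by rewrite coefB coefZ cn mulr1 subrr.
  have pj : (size p <= j)%N := leq_trans pn nj.
  by rewrite coefB coefZ (nth_default _ pj) [(centfact n)`_j]nth_default ?sz // mulr0 subrr.
exists (fun k => if (k < n)%N then c k else p`_n).
rewrite big_ord_recr /= ltnn -[LHS](subrK (p`_n *: centfact n)) pE.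
by congr (_ + _); apply: eq_bigr => i _; rewrite ltn_ord.
Qed.

Lemma centfact2_ex : exists T : nat -> nat -> R,
  forall n, 'X^n = \sum_(k < n.+1) T n k *: centfact k.
Proof.
suff /choice[T TP] : forall n, exists c : nat -> R,
    'X^n = \sum_(k < n.+1) c k *: centfact k by exists T.
by move=> n; apply: centfact_basis; rewrite size_polyXn.
Qed.

(* The central factorial numbers of the second kind: for k <= n, T(n, k) is the
   coefficient in x^n = \sum_(k <= n) T(n, k) x^[k], unique by
   [centfact_monic_size]; unconstrained for k > n. *)
Definition centfact2 : nat -> nat -> R := projT1 (cid centfact2_ex).

Lemma centfact2P n : 'X^n = \sum_(k < n.+1) centfact2 n k *: centfact k.
Proof. exact: (projT2 (cid centfact2_ex) n). Qed.

End Series.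

(* Main.v *)
Require Import Defs.
From mathcomp Require Import all_boot all_order all_algebra.
From mathcomp Require Import ring.
From mathcomp Require Import reals exp.

(* Write E = e^t.  Multiplying the generating series of the d_l^{(-k)} by
   log(1+t)^k gives ((1+t) - (1+t)^-1)^k; substituting t := E - 1 turns this into
   (sum_l d_l^{(-k)} (E-1)^l / l!) t^k = (E - E^-1)^k.  It remains to see that
   (E - E^-1)^k / k! is the exponential generating series of 2^m T(m, k).  With
   s = E - E^-1 one has (s^k)'' = k^2 s^k + 4 k (k-1) s^(k-2), which is dual to
   x^2 x^[k] = x^[k+2] + (k^2/4) x^[k]; hence the coefficients of s^k satisfy the
   relation that characterises T(m, k). *)

Import Order.TTheory GRing.Theory Num.Theory.

Local Open Scope ring_scope.

(** * Substitution of formal power series *)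

Section Composition.
Set Implicit Arguments.
Unset Strict Implicit.
Variable R : comNzRingType.
Implicit Types f g h : fps R.

(** Since [h] has no constant term, powers [h ^+ j] with j > N do not reach coefficient n, so only
    the first coefficients of [p] matter. As [horner_alg h] is a ring morphism, multiplicativity of
    substitution reduces to polynomials. *)
Lemma fps_comp_horner (h g : fps R) (p : {poly R}) (N n : nat) :
  h 0%N = 0 -> (n <= N)%N -> (forall j, (j <= N)%N -> p`_j = g j) ->
  fps_comp g h n = (horner_alg h p) n.
Proof.
move=> h0 nN pg; rewrite (fps_comp_trunc g h0 (leq_trans nN (leq_maxl N (size p)))).
rewrite /horner_alg /horner_morph (@horner_coef_wide _ (maxn N (size p)).+1); last first.
  by rewrite (leq_trans (size_poly _ _)) // leqW // leq_maxr.
rewrite !fps_coef_sum; apply: eq_bigr => j _.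
rewrite coef_map -[X in X * _]/((p`_j)%:A) mulr_algl !fps_coefZ.
have [jN|Nj] := leqP j N; first by rewrite pg.
by rewrite fps_exp_lt ?mulr0 // (leq_ltn_trans nN).
Qed.

Lemma fps_coef_comp g h n :
  fps_comp g h n = \sum_(j < n.+1) g j * (h ^+ j) n.
Proof. by []. Qed.

Lemma fps_compM f g h : h 0%N = 0 ->
  fps_comp (f * g) h = fps_comp f h * fps_comp g h.
Proof.
move=> h0; apply/fpsP => n.
pose tr (f : fps R) : {poly R} := \poly_(i < n.+1) f i.
have trE u j : (j <= n)%N -> (tr u)`_j = u j by move=> jn; rewrite coef_poly ltnS jn.
rewrite (@fps_comp_horner h _ (tr f * tr g) n) //; last first.
  move=> j jn; rewrite coefM fps_coefM; apply: eq_bigr => i _.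
  by rewrite !trE // ?(leq_trans (leq_subr _ _)) // (leq_trans _ jn) // -ltnS.
rewrite rmorphM !fps_coefM; apply: eq_bigr => i _; have in_ : (i <= n)%N by rewrite -ltnS.
by congr (_ * _); apply/esym/(@fps_comp_horner _ _ _ n); rewrite ?leq_subr //; apply: trE.
Qed.

Lemma fps_compD f g h : fps_comp (f + g) h = fps_comp f h + fps_comp g h.
Proof.
apply/fpsP => n; rewrite fps_coefD /= -big_split.
by apply: eq_bigr => i _; rewrite mulrDl.
Qed.

Lemma fps_compB f g h : fps_comp (f - g) h = fps_comp f h - fps_comp g h.
Proof.
apply/fpsP => n; rewrite fps_coefB /= -sumrB.
by apply: eq_bigr => i _; rewrite mulrBl.
Qed.

Lemma fps_comp1 h : fps_comp 1 h = 1.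
Proof.
apply/fpsP => n /=; rewrite big_ord_recl /= mul1r big1 ?addr0 // => i _.
by rewrite mul0r.
Qed.

Lemma fps_compX h : h 0%N = 0 -> fps_comp fpsX h = h.
Proof.
move=> h0; apply/fpsP => n.
rewrite (fps_comp_trunc _ h0 (leqnSn n)) !big_ord_recl big1 => [|i _]; last exact: scale0r.
by rewrite scale0r add0r addr0 scale1r.
Qed.

Lemma fps_compXn f h k : h 0%N = 0 -> fps_comp (f ^+ k) h = fps_comp f h ^+ k.
Proof.
move=> h0; elim: k => [|k IHk]; first exact: fps_comp1.
by rewrite !exprS fps_compM // IHk.
Qed.

Lemma fps_coefXM f n : (fpsX * f) n = if n is m.+1 then f m else 0.
Proof.
case: n => [|n]; rewrite fps_coefM; first by rewrite big_ord1 mul0r.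
rewrite 2!big_ord_recl /= mul0r mul1r add0r subSS subn0 big1 ?addr0 // => i _.
by rewrite mul0r.
Qed.

Lemma fps_coefMXn f k n : (f * fpsX ^+ k) (n + k)%N = f n.
Proof.
elim: k n => [|k IHk] n; first by rewrite mulr1 addn0.
by rewrite exprS mulrCA addnS fps_coefXM IHk.
Qed.

(** * Formal derivative: product, power and chain rules *)

Definition fps_deriv f : fps R := Fps (fun n => n.+1%:R * f n.+1).

Lemma fps_derivD f g : fps_deriv (f + g) = fps_deriv f + fps_deriv g.
Proof. by apply/fpsP => n /=; rewrite mulrDr. Qed.

Lemma fps_derivB f g : fps_deriv (f - g) = fps_deriv f - fps_deriv g.
Proof. by apply/fpsP => n /=; rewrite mulrDr mulrN. Qed.

Lemma fps_derivZ a f : fps_deriv (a *: f) = a *: fps_deriv f.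
Proof. by apply/fpsP => n /=; rewrite mulrCA. Qed.

Lemma fps_deriv1 : fps_deriv 1 = 0.
Proof. by apply/fpsP => n /=; rewrite mulr0. Qed.

Lemma fps_derivM f g : fps_deriv (f * g) = fps_deriv f * g + f * fps_deriv g.
Proof.
apply/fpsP => n; rewrite fps_coefD /= mulr_sumr.
rewrite (eq_bigr (fun i : 'I_n.+2 =>
  i%:R * f i * g (n.+1 - i)%N + f i * ((n.+1 - i)%:R * g (n.+1 - i)%N))).
  rewrite big_split /=; congr (_ + _).
    by rewrite big_ord_recl /= !mul0r add0r.
  rewrite big_ord_recr /= subnn mul0r mulr0 addr0.
  by apply: eq_bigr => i _; rewrite subSn // -ltnS.
move=> i _; have -> : n.+1%:R = i%:R + (n.+1 - i)%:R :> R.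
  by rewrite -natrD subnKC // -ltnS.
ring.
Qed.

Lemma fps_derivXn f k : fps_deriv (f ^+ k.+1) = (f ^+ k * fps_deriv f) *+ k.+1.
Proof.
elim: k => [|k IHk]; first by rewrite expr1 expr0 mul1r.
by rewrite exprS fps_derivM IHk -mulrnAr mulrA -exprS mulrnAr mulrC -mulrS.
Qed.

Lemma fps_deriv_comp g h : h 0%N = 0 ->
  fps_deriv (fps_comp g h) = fps_comp (fps_deriv g) h * fps_deriv h.
Proof.
move=> h0; apply/fpsP => n.
transitivity ((\sum_(j < n.+1) (fps_deriv g) j *: h ^+ j * fps_deriv h) n).
  (* Coefficient n of a derivative reads coefficient n+1, so the truncation needs one more term. *)
  transitivity (fps_deriv (\sum_(j < n.+2) g j *: h ^+ j) n).
    by congr (_ * _); apply: fps_comp_trunc.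
  congr (fps_coef _ n).
  have d0 : fps_deriv (0 : fps R) = 0 by apply/fpsP => m /=; rewrite mulr0.
  rewrite (big_morph _ fps_derivD d0).
  rewrite big_ord_recl /= fps_derivZ expr0 fps_deriv1 scaler0 add0r.
  apply: eq_bigr => j _; rewrite fps_derivZ fps_derivXn /= /bump /=.
  by rewrite -scalerAl -scaler_nat scalerA [g _ * _]mulrC.
rewrite -mulr_suml !fps_coefM; apply: eq_bigr => i _; congr (_ * _).
by rewrite [RHS](@fps_comp_trunc _ _ _ n) // -ltnS.
Qed.

End Composition.

(** * Powers with real exponent *)

Section Daehee.
Set Implicit Arguments.
Unset Strict Implicit.
Variable R : realType.
Implicit Types (f g : fps R) (a : R).

(** In characteristic 0 each n+1 can be cancelled. This turns identities between exponential and
    logarithm into checks on derivatives. *)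
Lemma fps_deriv_eq f g : f 0%N = g 0%N -> fps_deriv f = fps_deriv g -> f = g.
Proof.
move=> fg0 /fpsP fg; apply/fpsP => -[//|n].
by apply: (mulfI _ (fg n)); rewrite pnatr_eq0.
Qed.

(** Pascal's rule for a real upper argument: after removing the common product of the a - i for i <
    j, it reads a + 1 = (a - j) + (j + 1). *)
Lemma gbinomS a j : gbinom (a + 1) j.+1 = gbinom a j.+1 + gbinom a j.
Proof.
rewrite /gbinom big_ord_recl [in X in _ = X + _]big_ord_recr /=.
rewrite (eq_bigr (fun i : 'I_j => a - i%:R)); last first.
  by move=> i _; rewrite /bump /= add1n -natr1; ring.
have fn0 : j`!%:R != 0 :> R by rewrite pnatr_eq0 -lt0n fact_gt0.
have jn0 : j.+1%:R != 0 :> R by rewrite pnatr_eq0.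
rewrite factS natrM; move: jn0; rewrite -natr1 => jn0.
by field; rewrite fn0.
Qed.

(** By [gbinomS], the binomial series of exponent a + 1 is 1 + t times that of exponent a;
    substitute t := f/f_0 - 1. *)
Lemma fps_powrD1 f a : 0 < f 0%N -> fps_powr f (a + 1) = fps_powr f a * f.
Proof.
move=> f0; have fn0 := lt0r_neq0 f0.
set u := (f 0%N)^-1 *: f - 1.
have u0 : u 0%N = 0 by rewrite /u fps_coefB fps_coefZ mulVf // subrr.
have fE : f = f 0%N *: (1 + u) by rewrite addrC /u subrK scalerA divff // scale1r.
rewrite /fps_powr -/u [in X in _ = _ * X]fE -scalerAl -scalerAr scalerA.
rewrite powRD ?fn0 ?implybT // powRr1 ?ltW //; congr (_ *: _).
have uE : 1 + u = fps_comp (1 + fpsX) u by rewrite fps_compD fps_comp1 fps_compX.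
rewrite uE -fps_compM //; congr fps_comp; apply/fpsP => -[|n].
  by rewrite fps_coefM big_ord1 /= /gbinom !big_ord0 addr0 mulr1.
by rewrite mulrDr mulr1 fps_coefD [_ * fpsX]mulrC fps_coefXM; apply: gbinomS.
Qed.

Lemma fps_powrNn f k : 0 < f 0%N -> fps_powr f (- k%:R) * f ^+ k = 1.
Proof.
move=> f0; elim: k => [|k IHk]; first by rewrite mulr1 oppr0 (@fps_powrn _ f 0).
rewrite exprS mulrA -fps_powrD1 // -natr1.
by rewrite opprD subrK.
Qed.

(** * The exponential series and the substitution t := e^t - 1 *)

Definition fps_expN : fps R := Fps (fun n => (-1) ^+ n / n`!%:R).

Local Notation E := (fps_exp R).
Local Notation F := fps_expN.

Lemma fps_deriv_exp : fps_deriv E = E.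
Proof.
apply/fpsP => n /=; rewrite factS natrM invfM mulrA divff ?mul1r //.
by rewrite pnatr_eq0.
Qed.

Lemma fps_deriv_expN : fps_deriv F = - F.
Proof.
apply/fpsP => n /=; rewrite factS natrM invfM exprS mulN1r.
by rewrite mulNr mulrN mulrCA mulVKf ?pnatr_eq0.
Qed.

Lemma fps_expK : E * F = 1.
Proof.
apply: fps_deriv_eq; first by rewrite fps_coefM big_ord1 /= fact0 invr1 !mulr1.
by rewrite fps_derivM fps_deriv_exp fps_deriv_expN mulrN subrr fps_deriv1.
Qed.

Lemma fps_exp_sub1_0 : (E - 1) 0%N = 0.
Proof. by rewrite fps_coefB /= fact0 invr1 subrr. Qed.
Local Notation h0 := fps_exp_sub1_0.

Lemma fps_comp_1X : fps_comp (1 + fpsX) (E - 1) = E.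
Proof. by rewrite fps_compD fps_comp1 fps_compX ?h0 // addrC subrK. Qed.

Lemma fps_deriv_log1p : (1 + fpsX) * fps_deriv (fps_log1p R) = 1.
Proof.
have dE n : fps_deriv (fps_log1p R) n = (-1) ^+ n.
  by rewrite /= mulrCA divff ?pnatr_eq0 // mulr1.
apply/fpsP => -[|n]; rewrite mulrDl mul1r fps_coefD fps_coefXM !dE ?addr0 //.
by rewrite exprS mulN1r addNr.
Qed.

(** Both sides vanish at 0 and have derivative 1: by the chain rule the left one has derivative
    (1+t)^-1 at t := E - 1, times E. *)
Lemma fps_log1p_exp : fps_comp (fps_log1p R) (E - 1) = fpsX.
Proof.
apply: fps_deriv_eq; first by rewrite /= big_ord1 /= invr0 mulr0 mul0r.
rewrite fps_deriv_comp ?h0 // fps_derivB fps_deriv1 subr0 fps_deriv_exp mulrC.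
rewrite -[X in X * _]fps_comp_1X -fps_compM ?h0 // fps_deriv_log1p fps_comp1.
by apply/fpsP => -[|n] /=; rewrite ?mulr1 ?mulr0.
Qed.

Lemma fps_daehee_den_exp : fps_comp (fps_daehee_den R) (E - 1) = E - F.
Proof.
rewrite /fps_daehee_den fps_compB fps_comp_1X; congr (_ - _).
have : E * fps_comp (fps_inv (1 + fpsX)) (E - 1) = 1.
  rewrite -[X in X * _]fps_comp_1X -fps_compM ?h0 // fps_mulV ?fps_comp1 //.
  by rewrite fps_coefD addr0 oner_eq0.
by move=> /(congr1 ( *%R F)); rewrite mulrA [F * E]mulrC fps_expK mul1r mulr1.
Qed.

(** * Daehee numbers of order -k and powers of e^t - e^-t *)

Lemma daehee_comp_exp k :
  fps_comp (fps_powr (fps_daehee_base R) (- k%:R)) (E - 1) * fpsX ^+ k = (E - F) ^+ k.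
Proof.
rewrite -fps_log1p_exp -fps_daehee_den_exp -!fps_compXn ?h0 // -fps_compM ?h0 //.
congr fps_comp; rewrite -fps_daehee_baseE exprMn mulrA fps_powrNn ?mul1r //.
by rewrite fps_daehee_base0 invr_gt0 ltr0n.
Qed.

Lemma sum_daehee_stirling2 k n :
  \sum_(l < n.+1) daehee (- k%:R) l * stirling2 R n l =
  n`!%:R * ((E - F) ^+ k) (n + k)%N.
Proof.
rewrite -daehee_comp_exp fps_coefMXn fps_coef_comp mulr_sumr; apply: eq_bigr => l _.
(* At x = 0 the factor (1+t)^x is 1; then l! from the Daehee number cancels 1/l! from the Stirling
   number. *)
rewrite /daehee /daehee_poly (@fps_powrn _ _ 0) ?fps_coefD ?addr0 ?ltr01 //.
rewrite expr0 mulr1 /stirling2 fps_coefZ [l`!%:R * _]mulrC mulrCA -mulrA mulVKf //.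
by rewrite pnatr_eq0 -lt0n fact_gt0.
Qed.

(** With S = E - F and C = E + F one has S' = C, C' = S and C^2 = S^2 + 4 E F = S^2 + 4, so (S^k)''
    = k (k-1) S^(k-2) C^2 + k S^k. *)
Lemma fps_sinh_ode k : fps_deriv (fps_deriv ((E - F) ^+ k)) =
  (k%:R ^+ 2) *: (E - F) ^+ k + (4 * k%:R * k.-1%:R) *: (E - F) ^+ k.-2.
Proof.
have dS : fps_deriv (E - F) = E + F.
  by rewrite fps_derivB fps_deriv_exp fps_deriv_expN opprK.
have dC : fps_deriv (E + F) = E - F.
  by rewrite fps_derivD fps_deriv_exp fps_deriv_expN.
have C2 : (E + F) * (E + F) = (E - F) ^+ 2 + 4.
  by transitivity ((E - F) ^+ 2 + 4 * (E * F)); [ring | rewrite fps_expK mulr1].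
(* For k < 2 the exponent [k.-2] is cut off at 0, but its coefficient vanishes. *)
case: k => [|[|k]].
- by rewrite !fps_deriv1 mulr0 expr0n !scale0r addr0; apply/fpsP => n /=; rewrite mulr0.
- by rewrite expr1 dS dC mulr0 scale0r addr0 expr1n scale1r.
have natZ (m : nat) (f : fps R) : m%:R *: f = m%:R * f by rewrite scaler_nat mulr_natl.
rewrite fps_derivXn -scaler_nat fps_derivZ fps_derivM fps_derivXn dS dC -scaler_nat.
rewrite -natrX -!natrM !natZ !natrM /= -!mulrA C2 !exprS expr0.
ring.
Qed.

(** * Central factorials and their connection coefficients *)

Lemma centfactSS k :
  'X^2 * centfact R k = centfact R k.+2 + (k%:R ^+ 2 / 4)%:P * centfact R k.
Proof.
case: k => [|k] /=.
  by rewrite big_nat1 divff ?pnatr_eq0 // subrr expr0n mul0r; ring.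
(* The last and first factors split off here are x - a and x + a with a = (k+1)/2; the remaining
   ones, shifted by one index, are those of [centfact k.+1]. Then x^2 = (x + a)(x - a) + a^2. *)
rewrite [in RHS]big_nat_recr // [in RHS]big_nat_recl //=.
rewrite [X in _ * X * _](eq_bigr (fun i => 'X + (k.+1%:R / 2 - i%:R)%:P)); last first.
  by move=> i _; congr ('X + _%:P); rewrite -!natr1; field.
set P := (X in 'X^2 * ('X * X)); rewrite -/P.
have -> : (k.+3%:R / 2 - 1)%:P = (k.+1%:R / 2)%:P :> {poly R}.
  by congr (_%:P); rewrite -!natr1; field.
have -> : (k.+3%:R / 2 - k.+2%:R)%:P = - (k.+1%:R / 2)%:P :> {poly R}.
  by rewrite -polyCN; congr (_%:P); rewrite -!natr1; field.
have -> : (k.+1%:R ^+ 2 / 4)%:P = (k.+1%:R / 2)%:P ^+ 2 :> {poly R}.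
  by rewrite -polyC_exp; congr (_%:P); field.
move: P (_%:P) => P a; ring.
Qed.

(** The polynomials are monic with strictly increasing degrees, so the top coefficients agree and
    can be peeled off. *)
Lemma centfact_lin_indep N (c d : nat -> R) :
  \sum_(k < N) c k *: centfact R k = \sum_(k < N) d k *: centfact R k ->
  forall k, (k < N)%N -> c k = d k.
Proof.
elim: N => // N IHN; rewrite !big_ord_recr /= => cd.
have [/monicP mon sz] := centfact_monic_size R N.
have low (e : nat -> R) : (\sum_(k < N) e k *: centfact R k)`_N = 0.
  rewrite coef_sum big1 // => i _; rewrite coefZ nth_default ?mulr0 //.
  by rewrite (centfact_monic_size R i).2.
have cdN : c N = d N.
  have cN : (centfact R N)`_N = 1 by rewrite -mon lead_coefE sz.
  by move/(congr1 (fun p : {poly R} => p`_N)): cd; rewrite !coefD !low !coefZ cN !add0r !mulr1.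
move: cd; rewrite cdN => /addIr/IHN cd k; rewrite ltnS leq_eqVlt.
by case/predU1P => [->|/cd].
Qed.

(* n! / (k! 2^n) [t^n] (e^t - e^-t)^k, that is n! [t^n] (2 sinh(t/2))^k / k! *)
Definition sinh_coef (n k : nat) : R :=
  n`!%:R / (k`!%:R * 2 ^+ n) * ((E - F) ^+ k) n.

Lemma sinh_coef_lt n k : (n < k)%N -> sinh_coef n k = 0.
Proof.
by move=> nk; rewrite /sinh_coef fps_exp_lt ?mulr0 // fps_coefB /= mul1r subrr.
Qed.

(** Coefficient n of [fps_sinh_ode], rescaled: k (k-1) turns k! into (k-2)!, and 2^(n+2) contributes
    the 4. *)
Lemma sinh_coefSS n k : sinh_coef n.+2 k =
  k%:R ^+ 2 / 4 * sinh_coef n k + (if (1 < k)%N then sinh_coef n k.-2 else 0).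
Proof.
have fn0 m : m`!%:R != 0 :> R by rewrite pnatr_eq0 -lt0n fact_gt0.
have := fps_sinh_ode k => /fpsP /(_ n); rewrite fps_coefD !fps_coefZ /= => ode.
transitivity (n`!%:R / (k`!%:R * 2 ^+ n.+2) *
    (n.+1%:R * (n.+2%:R * ((E - F) ^+ k) n.+2))).
  rewrite /sinh_coef !factS !natrM; field.
  by rewrite fn0 expf_neq0 ?pnatr_eq0.
rewrite ode /sinh_coef mulrDr.
have p2 : 2 ^+ n != 0 :> R by rewrite expf_neq0 ?pnatr_eq0.
congr (_ + _); first by rewrite !exprS; field; rewrite p2 fn0.
case: k {ode} => [|[|k]] /=; rewrite ?mulr0 ?mul0r ?mulr0 //.
rewrite !factS !natrM !exprS; field.
by rewrite p2 fn0 !nat1r -?natrD ?pnatr_eq0 //=.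
Qed.

(** Induction in steps of two, matching [sinh_coefSS] against [centfactSS] after multiplying the
    expansion of x^n by x^2. *)
Lemma sum_sinh_coef n :
  \sum_(k < n.+1) sinh_coef n k *: centfact R k = 'X^n.
Proof.
elim/ltn_ind: n => -[|[|n]] IHn.
- by rewrite big_ord1 /sinh_coef fact0 !mulr1 divr1 scale1r.
- have c0 : sinh_coef 1 0 = 0 by rewrite /sinh_coef expr0 fps_coef1 mulr0.
  have c1 : sinh_coef 1 1 = 1.
    by rewrite /sinh_coef fps_coefB /= !factS fact0; field.
  by rewrite big_ord_recl big_ord1 c0 c1 scale0r add0r scale1r /= big_geq // mulr1.
rewrite [RHS](exprD 'X 2 n) -(IHn n) // mulr_sumr.
rewrite (eq_bigr (fun k : 'I__ => ((k%:R ^+ 2 / 4 * sinh_coef n k) *: centfact R k)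
  + (if (1 < k)%N then sinh_coef n k.-2 else 0) *: centfact R k)); last first.
  by move=> k _; rewrite sinh_coefSS scalerDl.
rewrite big_split /=.
(* The terms k = n+1 and k = n+2 of the first sum vanish by [sinh_coef_lt]. *)
rewrite [X in X + _]big_ord_recr [X in X + _ + _]big_ord_recr /=.
rewrite !sinh_coef_lt // !mulr0 !scale0r !addr0.
(* Dropping the zero terms k = 0, 1 of the second sum shifts its index by two, so both sums run over
   the same range. *)
rewrite [X in _ + X]big_ord_recl [X in _ + (_ + X)]big_ord_recl /= !scale0r !add0r.
rewrite -big_split; apply: eq_bigr => i _ /=.
by rewrite /bump /= !add1n -scalerAr centfactSS scalerDr addrC mul_polyC scalerA [_ / 4 * _]mulrC.
Qed.

Lemma centfact2_sinh n k : (k <= n)%N -> centfact2 R n k = sinh_coef n k.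
Proof.
move=> kn; apply: (@centfact_lin_indep n.+1) => //.
by rewrite -centfact2P sum_sinh_coef.
Qed.

End Daehee.

Theorem theorem6 (R : realType) (n k : nat) :
  2 ^+ (n + k) * centfact2 R (n + k) k =
  'C(n + k, k)%:R * \sum_(l < n.+1) daehee (- k%:R) l * stirling2 R n l.
Proof.
rewrite centfact2_sinh ?leq_addl // sum_daehee_stirling2 /sinh_coef.
have fn0 m : m`!%:R != 0 :> R by rewrite pnatr_eq0 -lt0n fact_gt0.
have p2 : 2 ^+ (n + k) != 0 :> R by rewrite expf_neq0 ?pnatr_eq0.
(* Writing (n+k)! as the binomial times k! n! leaves only cancellations. *)
rewrite -(bin_fact (leq_addl n k)) addnK !natrM.
by field; rewrite fn0 p2.
Qed.
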